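(* In the game CRIM the following hold. The staircase $S_n$ ($n\ge1$) is a $\mathcal{P}$-position if and only if $n$ is even. Every padded staircase $\mathrm{PS}_n$ ($n\ge2$) is an $\mathcal{N}$-position. Every doubly padded staircase $\mathrm{DPS}_n$ ($n\ge2$) is a $\mathcal{P}$-position, and every quadrated partition is a $\mathcal{P}$-position.
   Context: A partition is a finite weakly decreasing sequence $\lambda=[\lambda_1,\ldots,\lambda_r]$ of positive integers, called its parts; the empty partition $[\,]$ is allowed. Its conjugate is $\lambda'=[\lambda'_1,\ldots,\lambda'_{\lambda_1}]$, where $\lambda'_k$ is the largest $i$ with $\lambda_i\ge k$. CRIM is the impartial two-player game whose positions are partitions. From $\lambda=[\lambda_1,\ldots,\lambda_r]$, a row move deletes the part $\lambda_i$ for some $1\le i\le r$. A column move takes the conjugate of the partition that results from making a row move on $\lambda'$ (i.e. it removes one column of the Young diagram). Play is normal play: the player to move at the terminal position $[\,]$ loses. A $\mathcal{P}$-position (losing position) is one from which the player who has just moved can force a win; an $\mathcal{N}$-position (winning position) is one from which the player about to move can force a win. Families of partitions: for $n\ge1$, the staircase is $S_n=[n,n-1,\ldots,1]$. For $n\ge2$, the padded staircase is $\mathrm{PS}_n=[n,n,n-1,\ldots,1]$, and the doubly padded staircase is $\mathrm{DPS}_n=[n+1,n+1,n,\ldots,2]$. A quadrated partition is one in which each part is even and appears an even number of times, i.e. one of the form $[\lambda_1^{m_1},\ldots,\lambda_t^{m_t}]$ (exponents denoting multiplicities) where each $\lambda_j$ and each $m_j$ is even. *)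

(* Defs.v *)
From mathcomp Require Import all_boot.

Set Implicit Arguments.
Unset Strict Implicit.
Unset Printing Implicit Defensive.

Definition is_partition (lam : seq nat) : bool :=
  sorted geq lam && all (fun p => 0 < p) lam.

(* With parts indexed from 1, the k-th part of the conjugate (1 <= k <= lam_1)
   is the largest i with lam_i >= k; [nth 0 lam i] below is lam_(i+1). *)
Definition conjugate (lam : seq nat) : seq nat :=
  [seq \max_(i < size lam | k <= nth 0 lam i) i.+1 | k <- iota 1 (head 0 lam)].

Definition delete_part (i : nat) (lam : seq nat) : seq nat :=
  take i lam ++ drop i.+1 lam.

Definition row_move (lam mu : seq nat) : Prop :=
  exists2 i, i < size lam & mu = delete_part i lam.

Definition column_move (lam mu : seq nat) : Prop :=
  exists2 nu, row_move (conjugate lam) nu & mu = conjugate nu.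

(* The positions of CRIM are the partitions; the relation is written on all
   lists, and [crim_move_partition] below shows that it preserves partitions. *)
Definition crim_move (lam mu : seq nat) : Prop :=
  row_move lam mu \/ column_move lam mu.

(* Normal play: a terminal position satisfies [P_position] vacuously. The least
   fixed point means that the win is forced after finitely many moves. *)
Inductive P_position (lam : seq nat) : Prop :=
  | P_position_intro of (forall mu, crim_move lam mu -> N_position mu)
with N_position (lam : seq nat) : Prop :=
  | N_position_intro mu of crim_move lam mu & P_position mu.

Definition staircase (n : nat) : seq nat := rev (iota 1 n).

Definition padded_staircase (n : nat) : seq nat := n :: staircase n.

(* [rev (iota 2 n)] is n+1, n, ..., 2. *)
Definition doubly_padded_staircase (n : nat) : seq nat :=
  n.+1 :: rev (iota 2 n).

Definition quadrated (lam : seq nat) : Prop :=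
  forall p, p \in lam -> ~~ odd p /\ ~~ odd (count_mem p lam).

Lemma delete_part_partition i lam :
  is_partition lam -> is_partition (delete_part i lam).
Proof.
case/andP=> slam plam; have sub : subseq (delete_part i lam) lam.
  rewrite /delete_part -[X in subseq _ X](cat_take_drop i lam).
  by rewrite cat_subseq // -addn1 addnC -drop_drop drop_subseq.
apply/andP; split; last by apply/allP => p /(mem_subseq sub) /(allP plam).
by apply: (subseq_sorted _ sub slam) => x y z /= xy yz; apply: leq_trans yz xy.
Qed.

Lemma conjugate_partition lam : is_partition (conjugate lam).
Proof.
apply/andP; split.
  rewrite /conjugate.
  apply: (@homo_sorted _ _ _ leq); last exact: iota_sorted.
  move=> k l kl /=; apply/bigmax_leqP => i li.
  by apply: (leq_bigmax_cond (F := fun j : 'I_(size lam) => j.+1)); apply: leq_trans kl li.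
apply/allP => _ /mapP[k kI ->]; move: kI; rewrite mem_iota add1n ltnS.
case/andP=> k0; case: lam => [|a s] /=; first by rewrite leqn0; case: k k0.
move=> ka; apply: leq_trans (leq_bigmax_cond (F := fun j : 'I_(size s).+1 => j.+1) ord0 _) => //.
Qed.

Lemma crim_move_partition lam mu :
  is_partition lam -> crim_move lam mu -> is_partition mu.
Proof.
move=> plam [[i _ ->]|[nu _ ->]]; first exact: delete_part_partition.
exact: conjugate_partition.
Qed.

(* Main.v *)
(* Walk along the boundary of the Young diagram from its top right corner,
   recording R for each row and C for each column. A move deletes one letter,
   after which leading C's and trailing R's may be dropped. A word is even when
   its length is. An odd number of letters remains after a move from an even
   word, except when the move strips a prefix R C^k or a suffix R^k C with k odd.
   Call a word stable if it starts with R C^(2i) R and ends with C R^(2j) C.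
   Every odd word is a win for the player to move; an even word is a loss for
   him if and only if an even number of strippings turns it into a stable or
   empty word. Doubly padded staircases and quadrated partitions are stable, the
   staircase S_n needs n strippings, and padded staircases are odd words. *)
Require Import Defs.
From mathcomp Require Import all_boot.
From mathcomp Require Import zify.

Set Implicit Arguments.
Unset Strict Implicit.
Unset Printing Implicit Defensive.

(** * Boundary words and the partitions they encode *)

(* [true] is a row letter R, [false] a column letter C. *)
Definition step_word := seq bool.

(** A row meets exactly those columns that the boundary walk records after it. Trailing R's give
    rows of length 0, which [shape] discards. *)
Fixpoint row_lengths (w : step_word) : seq nat :=
  if w is c :: w' then
    if c then count_mem false w' :: row_lengths w' else row_lengths w'
  else [::].

Definition shape (w : step_word) : seq nat := [seq p <- row_lengths w | 0 < p].

Definition transpose (w : step_word) : step_word := rev (map negb w).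

(** The default values of [head] and [last] make the empty word normal. In a normal word each letter
    stands for an actual row or column of the diagram. *)
Definition normal (w : step_word) : bool := head true w && ~~ last false w.

Lemma transposeK : involutive transpose.
Proof. by move=> w; rewrite /transpose map_rev revK mapK //; apply: negbK. Qed.

Lemma transpose_cat u v : transpose (u ++ v) = transpose v ++ transpose u.
Proof. by rewrite /transpose map_cat rev_cat. Qed.

Lemma transpose_cons c w : transpose (c :: w) = rcons (transpose w) (~~ c).
Proof. by rewrite /transpose /= rev_cons. Qed.

Lemma transpose_nseq n c : transpose (nseq n c) = nseq n (~~ c).
Proof.
by rewrite /transpose map_nseq rev_nseq.
Qed.

Lemma size_transpose w : size (transpose w) = size w.
Proof. by rewrite size_rev size_map. Qed.

Lemma head_transpose w : head true (transpose w) = ~~ last false w.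
Proof.
by elim/last_ind: w => // w c _; rewrite last_rcons -cats1 transpose_cat.
Qed.

Lemma normal_transpose w : normal (transpose w) = normal w.
Proof.
by rewrite /normal head_transpose andbC -head_transpose transposeK.
Qed.

Lemma row_lengths_rcons_col w :
  row_lengths (rcons w false) = map S (row_lengths w).
Proof.
by elim: w => //= -[] w IHw; rewrite IHw // -cats1 count_cat addn1.
Qed.

Lemma row_lengths_rcons_row w :
  row_lengths (rcons w true) = rcons (row_lengths w) 0.
Proof.
by elim: w => //= -[] w IHw; rewrite IHw // -cats1 count_cat addn0.
Qed.

Lemma row_lengths_le w : all (fun p => p <= count_mem false w) (row_lengths w).
Proof.
elim: w => //= -[|] w IHw /=; rewrite ?add0n ?leqnn //=.
by apply: sub_all IHw => p; lia.
Qed.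

Lemma sorted_row_lengths w : sorted geq (row_lengths w).
Proof.
elim: w => //= -[|] w IHw //=; have := row_lengths_le w.
by case: (row_lengths w) IHw => //= a s -> /andP[-> _].
Qed.

Lemma geq_trans : transitive geq.
Proof. by move=> y x z /= xy yz; apply: leq_trans yz xy. Qed.

Lemma sorted_shape w : sorted geq (shape w).
Proof. exact: (sorted_filter geq_trans) (sorted_row_lengths w). Qed.

(** * Conjugation as transposition of words *)

Lemma row_lengths_transpose w :
  row_lengths (transpose w) =
  [seq count (leq k) (row_lengths w) | k <- iota 1 (count_mem false w)].
Proof.
elim: w => // -[|] w IHw; rewrite transpose_cons.
  rewrite row_lengths_rcons_col IHw -map_comp /= add0n.
  apply/eq_in_map => k; rewrite mem_iota add1n ltnS => /andP[_ km] /=.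
  by rewrite km.
have -> : count_mem false (false :: w) = count_mem false w + 1 by rewrite addnC.
rewrite row_lengths_rcons_row IHw iotaD map_cat /= cats1.
(* The last index exceeds the number of C's in [w] by one, and no row is that long. *)
congr rcons; apply/esym/eqP; rewrite -leqn0 leqNgt -has_count -all_predC.
by apply: sub_all (row_lengths_le w) => p /=; lia.
Qed.

(** In a decreasing list the entries that are at least [k] form a prefix. Since [k] is positive, the
    default 0 of [nth] fails the bound past the end. *)
Lemma leq_nth_sorted k lam i : 0 < k -> sorted geq lam ->
  (k <= nth 0 lam i) = (i < count (leq k) lam).
Proof.
move=> k0; elim: lam i => [|a s IHs] i slam /=; first by rewrite nth_nil; lia.
have := IHs _ (path_sorted slam); case: (leqP k a) => ka IH.
  by case: i => [|i] /=; rewrite ?IH; lia.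
suff: count (leq k) s = 0.
  by case: i => [|i] /=; rewrite ?IH => ->; lia.
apply/eqP; rewrite -leqn0 leqNgt -has_count -all_predC.
by apply: sub_all (order_path_min geq_trans slam) => p /=; lia.
Qed.

Lemma conjugate_count lam : sorted geq lam ->
  conjugate lam = [seq count (leq k) lam | k <- iota 1 (head 0 lam)].
Proof.
move=> slam; apply/eq_in_map => k; rewrite mem_iota => /andP[k0 _].
rewrite (eq_bigl (fun i : 'I_(size lam) => i < count (leq k) lam)); last first.
  by move=> i; rewrite leq_nth_sorted.
apply/eqP; rewrite eqn_leq; apply/andP; split; first by apply/bigmax_leqP.
have := count_size (leq k) lam.
case E: (count _ _) => [|n] // ns.
by apply: (leq_bigmax_cond (F := fun j : 'I_(size lam) => j.+1) (Ordinal ns)) => /=.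
Qed.

Lemma conjugate_shape w : conjugate (shape w) = shape (transpose w).
Proof.
rewrite (conjugate_count (sorted_shape w)) /shape row_lengths_transpose filter_map.
have cnt k : 0 < k ->
    count (leq k) [seq p <- row_lengths w | 0 < p] = count (leq k) (row_lengths w).
  by move=> k0; rewrite count_filter; apply: eq_count => p /=; lia.
set lam := [seq p <- _ | _] in cnt *; set m := count_mem _ _.
have hm : head 0 lam <= m.
  have := row_lengths_le w; rewrite -/m => /allP le_m.
  rewrite /lam; case E: [seq _ <- _ | _] => [|a s] //=; apply: le_m.
  by have := mem_head a s; rewrite -E mem_filter => /andP[].
(* Leading C's of [w] become trailing R's of the transpose, of length 0; the filter keeps the
   indices up to the largest part. *)
have -> : [seq k <- iota 1 m | preim (fun k => count (leq k) (row_lengths w)) (ltn 0) k]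
          = iota 1 (head 0 lam).
  rewrite -(subnKC hm) iotaD filter_cat.
  rewrite (all_filterP _) ?(eq_in_filter (a2 := pred0)) ?filter_pred0 ?cats0 //.
    move=> k; rewrite mem_iota => /andP[k0 _] /=.
    have k1 : 0 < k by lia.
    by rewrite -(cnt k k1) -leq_nth_sorted ?sorted_shape // nth0; lia.
  apply/allP => k; rewrite mem_iota => /andP[k0 k1] /=.
  by rewrite -cnt // -leq_nth_sorted ?sorted_shape // nth0; lia.
by apply/eq_in_map => k; rewrite mem_iota => /andP[k0 _]; rewrite cnt.
Qed.

(** * Moves as deletions of a letter *)

Lemma shape_cols k w : shape (nseq k false ++ w) = shape w.
Proof. by elim: k. Qed.

Lemma shape_rows k w : shape (w ++ nseq k true) = shape w.
Proof.
elim: k => [|k IHk]; rewrite ?cats0 // -addn1 nseqD catA cats1.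
by rewrite /shape row_lengths_rcons_row filter_rcons.
Qed.

Lemma shape_row_lengths w : ~~ last false w -> shape w = row_lengths w.
Proof.
elim/last_ind: w => // w [|]; rewrite last_rcons // => _.
by rewrite /shape row_lengths_rcons_col; elim: (row_lengths w) => //= a s ->.
Qed.

(** Inserting R's changes no number of C's, so one prefix [s] serves every [x]. The values 0 and 1
    compare a word without and with a given R. *)
Lemma row_lengths_cat u v : exists s,
  forall x, row_lengths (u ++ nseq x true ++ v) = s ++ row_lengths (nseq x true ++ v).
Proof.
elim: u => [|c u [s IHu]]; first by exists [::].
exists (if c then count_mem false (u ++ v) :: s else s) => x /=.
by rewrite IHu !count_cat count_nseq mul0n; case: c.
Qed.

Lemma row_move_row_lengths w i : i < size (row_lengths w) ->
  exists u v, w = u ++ true :: v /\ delete_part i (row_lengths w) = row_lengths (u ++ v).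
Proof.
elim: w i => // c w IHw i /=.
have recs j : j < size (row_lengths w) -> exists u v, [/\ w = u ++ true :: v,
    count_mem false w = count_mem false (u ++ v) &
    delete_part j (row_lengths w) = row_lengths (u ++ v)].
  move=> /IHw[u [v [-> ->]]]; exists u, v; split=> //.
  by rewrite !count_cat /= add0n.
case: c => [|/recs[u [v [e _ d]]]]; last by exists (false :: u), v; rewrite d e.
case: i => [_|i /recs[u [v [e c d]]]].
  by exists [::], w; rewrite /delete_part /= drop0.
exists (true :: u), v; split; first by rewrite e.
by rewrite /= -c -d.
Qed.

Lemma last_delete_row u v : ~~ last false (u ++ true :: v) -> ~~ last false (u ++ v).
Proof. by rewrite !last_cat; case: v. Qed.

(** Without a trailing R every row has positive length, so [shape] filters nothing out and the parts
    correspond to the R's. *)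
Lemma row_move_shape w mu : normal w ->
  row_move (shape w) mu <->
  exists u v, w = u ++ true :: v /\ mu = shape (u ++ v).
Proof.
case/andP=> _ lw; rewrite (shape_row_lengths lw); split=> [[i iw ->]|[u [v [e ->]]]].
  have [u [v [e ->]]] := row_move_row_lengths iw; exists u, v; split=> //.
  by rewrite shape_row_lengths // last_delete_row // -e.
have luv : ~~ last false (u ++ v) by apply: last_delete_row; rewrite -e.
rewrite (shape_row_lengths luv).
have [s eq_s] := row_lengths_cat u v; rewrite e.
have := eq_s 0; have := eq_s 1; rewrite /= => -> ->.
exists (size s); first by rewrite size_cat /=; lia.
by rewrite /delete_part take_size_cat // -cat_rcons drop_size_cat // size_rcons.
Qed.

Lemma crim_move_shape w mu : normal w ->
  crim_move (shape w) mu <->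
  exists u c v, w = u ++ c :: v /\ mu = shape (u ++ v).
Proof.
move=> nw; have nt : normal (transpose w) by rewrite normal_transpose.
split=> [[/(row_move_shape _ nw)[u [v [-> ->]]]|[nu]]|[u [[|] [v [e ->]]]]].
- by exists u, true, v.
- rewrite conjugate_shape => /(row_move_shape _ nt)[u [v [e ->]]] ->.
  exists (transpose v), false, (transpose u); split.
    by rewrite -[w]transposeK e transpose_cat transpose_cons cat_rcons.
  by rewrite conjugate_shape transpose_cat.
- by left; apply/(row_move_shape _ nw); exists u, v.
right; exists (shape (transpose (u ++ v))); last by rewrite conjugate_shape transposeK.
rewrite conjugate_shape; apply/(row_move_shape _ nt).
exists (transpose v), (transpose u); split; last by rewrite transpose_cat.
by rewrite e transpose_cat transpose_cons cat_rcons.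
Qed.

(** * Strippings and the outcome of an even word *)

(** The even run between the two R's is what forbids stripping here. The condition at the other end
    is stated through [transpose]. *)
Definition left_stable (w : step_word) : Prop :=
  exists i z, w = true :: nseq i.*2 false ++ true :: z.

(* In [outcome b w] the boolean [b] says whether the even word [w] is lost for
   the player to move. *)
Inductive outcome : bool -> step_word -> Prop :=
| outcome_nil : outcome true [::]
| outcome_stable w : left_stable w -> left_stable (transpose w) ->
    ~~ odd (size w) -> outcome true w
| outcome_left b k u : odd k -> outcome b u ->
    outcome (~~ b) (true :: nseq k false ++ u)
| outcome_right b k u : odd k -> outcome b u ->
    outcome (~~ b) (u ++ rcons (nseq k true) false).

Lemma transpose_left k u :
  transpose (true :: nseq k false ++ u) = transpose u ++ rcons (nseq k true) false.
Proof. by rewrite transpose_cons transpose_cat transpose_nseq rcons_cat. Qed.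

Lemma transpose_right k u :
  transpose (u ++ rcons (nseq k true) false) = true :: nseq k false ++ transpose u.
Proof. by rewrite -[u]transposeK -transpose_left !transposeK. Qed.

Lemma outcome_transpose b w : outcome b w -> outcome b (transpose w).
Proof.
elim=> {b w} [|w lw rw sw|b k u ok _ IHu|b k u ok _ IHu].
- exact: outcome_nil.
- by apply: outcome_stable; rewrite ?transposeK ?size_transpose.
- by rewrite transpose_left; apply: outcome_right.
- by rewrite transpose_right; apply: outcome_left.
Qed.

Lemma left_stable_head w : left_stable w -> head true w.
Proof. by case=> i [z ->]. Qed.

Lemma left_stable_cat u v : left_stable u -> left_stable (u ++ v).
Proof. by case=> i [z ->]; exists i, (z ++ v); rewrite /= -catA. Qed.

Lemma normal_left k u : 0 < k -> normal u -> normal (true :: nseq k false ++ u).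
Proof.
rewrite /normal /= last_cat => k0 /andP[_ lu].
by case: u lu => // _; case: k k0 => //= k _; elim: k.
Qed.

Lemma normal_right k u : 0 < k -> normal u -> normal (u ++ rcons (nseq k true) false).
Proof.
by move=> k0 nu; rewrite -normal_transpose transpose_right normal_left // normal_transpose.
Qed.

Lemma outcome_normal b w : outcome b w -> normal w.
Proof.
elim=> {b w} [|w lw rw sw|b k u ok _ IHu|b k u ok _ IHu] //.
- by rewrite /normal left_stable_head // -head_transpose left_stable_head.
- by rewrite normal_left // odd_gt0.
- by rewrite normal_right // odd_gt0.
Qed.

Lemma cols_cat_inj i j u v : head true u -> head true v ->
  nseq i false ++ u = nseq j false ++ v -> i = j /\ u = v.
Proof.
move=> hu hv; elim: i j => [|i IHi] [|j] //= e.
- by move: hu; rewrite e.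
- by move: hv; rewrite -e.
by case: e => /IHi[-> ->].
Qed.

Lemma split_cols w : exists i v, w = nseq i false ++ v /\ head true v.
Proof.
elim: w => [|[] w [i [v [-> hv]]]]; first by exists 0, [::].
  by exists 0, (true :: nseq i false ++ v).
by exists i.+1, v.
Qed.

Lemma normal_tail k u : normal (true :: nseq k false ++ u) -> head true u -> normal u.
Proof. by rewrite /normal /= last_cat => + ->; case: u. Qed.

(** This makes the outcome independent of the order of strippings. Normality of [u] forces [k] to be
    the whole run of C's, so a derivation ending with a left stripping removes the same prefix.
    Strippings at opposite ends touch disjoint letters and commute, except on the word R C. *)
Lemma outcome_left_inv b k u : odd k -> normal u ->
  outcome b (true :: nseq k false ++ u) -> outcome (~~ b) u.
Proof.
move=> ok nu; move e: (true :: _) => w E.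
elim: E k u ok nu e => {b w} [//|w [i [z ->]] _ _|b j v oj Ev _|b j v oj Ev IHv] k u ok nu.
- move: (nu) => /andP[hu _] [].
  by move/(@cols_cat_inj _ _ _ (true :: z) hu isT)=> [ek _]; rewrite ek odd_double in ok.
- move: (nu) => /andP[hu _] []; case/andP: (outcome_normal Ev) => hv _.
  by case/(cols_cat_inj hu hv) => _ ->; rewrite negbK.
have j0 := odd_gt0 oj.
(* With [v] empty the whole word is the suffix, and matching it with R C^k leaves only R C. *)
case: v Ev IHv => [|c v] Ev IHv.
  case: k ok => // k _; case: j oj j0 => // -[|j] _ _ [] //.
  by case: k => // /= ->; rewrite negbK.
have := outcome_normal Ev; rewrite {1}/normal /=; case: c Ev IHv => // Ev IHv nv [].
have [i [v2 [ev hv2]]] := split_cols v.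
have /andP[hu _] := nu; rewrite ev -catA => /(cols_cat_inj hu)[].
  by case: v2 hv2 {ev} => //= _; case: j {oj} j0.
(* The run of C's lies inside the word before the suffix, so it is stripped there by induction and
   the suffix is put back. *)
move=> ek eu; subst i; rewrite eu; apply: outcome_right => //; apply: (IHv k) => //.
  by apply: (@normal_tail k) => //; rewrite -ev.
by rewrite ev.
Qed.

Lemma outcome_right_inv b k u : odd k -> normal u ->
  outcome b (u ++ rcons (nseq k true) false) -> outcome (~~ b) u.
Proof.
move=> ok nu /outcome_transpose; rewrite transpose_right => E.
rewrite -[u]transposeK; apply/outcome_transpose/(outcome_left_inv ok) => //.
by rewrite normal_transpose.
Qed.

(** * Options of odd words *)

(** The dropped runs are even so that a prefix R C^k can be put back: its run absorbs the dropped
    C's and stays odd. The same holds at the other end. *)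
Definition option_to (b : bool) (w : step_word) : Prop :=
  exists u c v i j x, [/\ w = u ++ c :: v,
    u ++ v = nseq i.*2 false ++ x ++ nseq j.*2 true & outcome b x].

Lemma option_to_transpose b w : option_to b w -> option_to b (transpose w).
Proof.
move=> [u [c [v [i [j [x [-> e Ex]]]]]]].
exists (transpose v), (~~ c), (transpose u), j, i, (transpose x); split.
- by rewrite transpose_cat transpose_cons cat_rcons.
- by rewrite -transpose_cat e !transpose_cat !transpose_nseq catA.
- exact: outcome_transpose.
Qed.

Lemma option_to_left b k w : odd k -> option_to b w ->
  option_to (~~ b) (true :: nseq k false ++ w).
Proof.
move=> ok [u [c [v [i [j [x [-> e Ex]]]]]]].
exists (true :: nseq k false ++ u), c, v, 0, j, (true :: nseq (k + i.*2) false ++ x).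
split; first by rewrite /= catA.
  by rewrite /= -!catA e nseqD -!catA.
by apply: outcome_left => //; rewrite oddD odd_double addbF.
Qed.

(* Stripping exchanges the two outcomes, so the first conjunct for a word needs
   [option_to false] for its stripped form; only a stable word may lack it. *)
Definition has_options (w : step_word) : Prop :=
  option_to true w /\
  (left_stable w /\ left_stable (transpose w) \/ option_to false w).

Lemma has_options_transpose w : has_options w -> has_options (transpose w).
Proof.
case=> o1 o2; split; first exact: option_to_transpose.
by case: o2 => [[l r]|/option_to_transpose]; [left; rewrite transposeK|right].
Qed.

Lemma has_options_left k u : odd k -> normal u -> odd (size u) ->
  has_options u -> has_options (true :: nseq k false ++ u).
Proof.
move=> ok nu su [o1 o2]; split; last by right; apply: (@option_to_left true).
case: o2 => [[_ ru]|]; last exact: option_to_left.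
case: k ok => // k ok.
(* As [u] is stable on the right, deleting one C makes the first run even and the whole word stable
   at both ends. *)
exists [:: true], false, (nseq k false ++ u), 0, 0, (true :: nseq k false ++ u).
split=> //=; first by rewrite cats0.
case: u nu su ru {o1} => // -[] // u nu su ru.
apply: outcome_stable.
- by exists k./2, u; rewrite even_halfK //; move: ok; rewrite /= negbK.
- by rewrite transpose_left; apply: left_stable_cat.
- by move: ok su; rewrite /= size_cat size_nseq /= oddD /= => /negbTE->; case: odd.
Qed.

Lemma has_options_right k u : odd k -> normal u -> odd (size u) ->
  has_options u -> has_options (u ++ rcons (nseq k true) false).
Proof.
move=> ok nu su cu; rewrite -[u]transposeK -transpose_left.
apply/has_options_transpose/has_options_left; rewrite ?normal_transpose ?size_transpose //.
exact: has_options_transpose.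
Qed.

(** Deleting the R leaves an even run of C's, which is dropped entirely. Deleting a C leaves an odd
    run, and one stripping empties the word. *)
Lemma has_options_column k : ~~ odd k -> 0 < k -> has_options (true :: nseq k false).
Proof.
move=> ek k0; have e2 : k = (k./2).*2 by rewrite even_halfK.
split; first exists [::], true, (nseq k false), k./2, 0, [::].
  by split; rewrite ?cats0 -?e2 //; apply: outcome_nil.
case: k ek k0 {e2} => // k ek _; right.
exists [:: true], false, (nseq k false), 0, 0, (true :: nseq k false ++ [::]).
split=> //=; first by rewrite !cats0.
by apply: (@outcome_left true) => //; [rewrite -[odd k]negbK | apply: outcome_nil].
Qed.

(** Induction on the length strips an odd run at either end; single rows and columns are the base
    cases. Otherwise the word is stable, and its odd length leaves a letter between the two stable
    ends; deleting that letter keeps both. *)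
Lemma odd_normal w : normal w -> odd (size w) -> has_options w.
Proof.
have [n] := ubnP (size w); elim: n w => // n IHn -[//|[] // w] sw nw ow.
have [k [v [ew hv]]] := split_cols w; subst w.
have nv := normal_tail nw hv.
move: sw ow; rewrite /= size_cat size_nseq oddD => sw ow.
case: v hv nv nw sw ow => [|[] // z] _ nv nw sw ow.
  rewrite cats0 in nw *; apply: has_options_column; first by rewrite addbF in ow.
  by case: k nw {sw ow}.
have [ok|ek] := boolP (odd k).
  apply: has_options_left => //; first by move: ow; rewrite ok /= negbK.
  by apply: IHn => //; [lia | move: ow; rewrite ok /= negbK].
rewrite (negbTE ek) /= negbK in ow.
(* From here the run after the first R is even and [z] has odd length; its final run R^m C is
   isolated next. *)
have hz : head true (transpose z).
  by rewrite head_transpose; case/andP: nv => _; case: (z) ow.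
case tz : (transpose z) hz => [|[] // y] _.
  by rewrite -[z]transposeK tz in ow.
have [m [v0 [ey hv0]]] := split_cols y.
have ez : z = transpose v0 ++ rcons (nseq m true) false.
  by rewrite -[z]transposeK tz ey transpose_left.
have lv0 : ~~ last false (transpose v0) by rewrite -head_transpose transposeK.
have sz : size z = size v0 + m.+1.
  by rewrite ez size_cat size_transpose size_rcons size_nseq.
case: v0 hv0 ey ez lv0 sz => [|[] // v1] _ ey ez lv0 sz.
  (* Here the second R of the left end belongs to the final run: it has [m.+1] R's, or [m.+2] if [k]
     is 0 and [w] is a single column transposed. *)
  have em : ~~ odd m by rewrite sz /= in ow.
  case: (posnP k) => [k0|k0].
    have -> : true :: nseq k false ++ true :: z = transpose (true :: nseq m.+2 false).
      by rewrite k0 ez -[nseq m.+2 false]cats0 transpose_left.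
    by apply/has_options_transpose/has_options_column => //=; rewrite negbK.
  have -> : true :: nseq k false ++ true :: z =
      (true :: nseq k false) ++ rcons (nseq m.+1 true) false by rewrite ez.
  apply: has_options_right => //=.
  - by rewrite -[nseq k false]cats0 normal_left.
  - by rewrite size_nseq.
  - exact: has_options_column.
rewrite sz oddD /= in ow.
have [om|em] := boolP (odd m).
  have -> : true :: nseq k false ++ true :: z =
      (true :: nseq k false ++ true :: transpose (true :: v1)) ++ rcons (nseq m true) false.
    by rewrite ez /= -catA.
  have ou : odd (size (true :: nseq k false ++ true :: transpose (true :: v1))).
    rewrite /= size_cat size_nseq oddD (negbTE ek) /= size_transpose /= negbK.
    by move: ow; rewrite om /=; case: odd.
  have nu : normal (true :: nseq k false ++ true :: transpose (true :: v1)).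
    rewrite /normal /= last_cat /=.
    by rewrite transpose_cons last_rcons.
  apply: has_options_right => //; apply: IHn => //.
  by move: sw; rewrite /= sz size_cat size_nseq /= size_transpose /=; lia.
(* Now [w] is R C^k R, then [transpose v1], then C R^m C, with [k] and [m] even. The middle has odd
   length, and its first letter [d] will be deleted. *)
have ov : odd (size (transpose v1)).
  by rewrite size_transpose; move: ow; rewrite (negbTE em) /=; case: odd.
rewrite transpose_cons in ez.
case: (transpose v1) ez ov => // d z2 ez ov.
have left_w y' : left_stable (true :: nseq k false ++ true :: y').
  by exists k./2, y'; rewrite even_halfK.
have right_w y' : left_stable (transpose (rcons y' false ++ rcons (nseq m true) false)).
  exists m./2, (transpose y').
  by rewrite transpose_right even_halfK // -cats1 transpose_cat.
have ew y' : true :: nseq k false ++ true :: (rcons y' false ++ rcons (nseq m true) false) =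
    rcons (true :: nseq k false ++ true :: y') false ++ rcons (nseq m true) false.
  by rewrite /= -!cats1 -!catA.
split; last by left; split; rewrite ?ez // ew; apply: right_w.
exists (true :: nseq k false ++ [:: true]), d, (rcons z2 false ++ rcons (nseq m true) false), 0, 0.
exists (true :: nseq k false ++ true :: (rcons z2 false ++ rcons (nseq m true) false)).
split; first by rewrite ez /= -catA.
  by rewrite cats0 /= -catA.
apply: outcome_stable => //; first by rewrite ew; apply: right_w.
rewrite /= !size_cat /= size_cat !size_rcons !size_nseq !oddD /= !oddD /=.
by move: ov; rewrite /= (negbTE ek) (negbTE em) => /negbTE ->.
Qed.

(** * The winning strategy *)

(** When the outcome is false, one move performs a stripping: deleting its R on the left, or its C
    on the right, lets the rest of the run drop. The bound on sizes feeds the induction in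
    [outcome_P]. *)
Lemma winning_move w : odd (size w) && normal w \/ outcome false w ->
  exists u c v x, [/\ w = u ++ c :: v, shape (u ++ v) = shape x,
    outcome true x & size x < size w].
Proof.
case=> [/andP[ow nw]|].
  have [[u [c [v [i [j [x [-> e Ex]]]]]]] _] := odd_normal nw ow.
  exists u, c, v, x; split=> //; first by rewrite e shape_cols shape_rows.
  have := congr1 size e; rewrite !size_cat !size_nseq /=; lia.
move e: false => b E; case: E e => // {b w} -[] k u ok Eu // _.
  exists [::], true, (nseq k false ++ u), u; split=> //; first by rewrite shape_cols.
  by rewrite /= size_cat; lia.
exists (u ++ nseq k true), false, [::], u; split=> //.
- by rewrite -cats1 catA.
- by rewrite cats0 shape_rows.
by rewrite size_cat size_rcons; lia.
Qed.

Lemma outcome_even b w : outcome b w -> ~~ odd (size w).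
Proof.
elim=> {b w} // b k u ok _ su.
  by rewrite /= size_cat size_nseq oddD ok (negbTE su).
by rewrite size_cat size_rcons size_nseq oddD /= ok (negbTE su).
Qed.

(** Deleting an inner letter leaves a normal word of odd length. Deleting the first letter also
    drops the [k] C's behind it: for even [k] an odd word remains, for odd [k] this is a stripping,
    which reverses the outcome. The last letter is the mirror case. *)
Lemma losing_move w u c v : outcome true w -> w = u ++ c :: v ->
  exists x, [/\ shape (u ++ v) = shape x, size x < size w, normal x &
    odd (size x) && normal x \/ outcome false x].
Proof.
move=> Ew ew; have nw := outcome_normal Ew; have sw := outcome_even Ew; subst w.
case: u Ew nw sw => [|d u] Ew nw sw.
  have [k [x [ev hx]]] := split_cols v; subst v.
  case: c Ew nw sw => // Ew nw sw; have nx := normal_tail nw hx.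
  exists x; split=> //; rewrite ?shape_cols //= ?size_cat; first by lia.
  have [ok|ek] := boolP (odd k); first by right; apply: (outcome_left_inv ok nx Ew).
  left; rewrite nx andbT; move: sw; rewrite /= size_cat size_nseq oddD (negbTE ek).
  by rewrite /= negbK.
case: v Ew nw sw => [|e v] Ew nw sw; last first.
  exists ((d :: u) ++ e :: v); have nx : normal ((d :: u) ++ e :: v).
    by move: nw; rewrite /normal /= !last_cat.
  split=> //; first by rewrite !size_cat /=; lia.
  left; rewrite nx andbT; move: sw; rewrite /= !size_cat /= !oddD /=.
  by case: odd; case: odd.
move: (d :: u) Ew nw sw => {d}u Ew nw sw.
have [k [x [eu hx]]] := split_cols (transpose u).
have {}eu : u = transpose x ++ nseq k true.
  by rewrite -[u]transposeK eu transpose_cat transpose_nseq.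
subst u; case: c Ew nw sw => Ew nw sw.
  by move: nw; rewrite /normal last_cat andbF.
rewrite -catA cats1 in Ew nw sw *.
have nx : normal (transpose x).
  rewrite normal_transpose; apply: (@normal_tail k) => //.
  by rewrite -[x]transposeK -transpose_right normal_transpose.
exists (transpose x); split=> //.
- by rewrite cats0 shape_rows.
- by rewrite size_cat size_rcons; lia.
have [ok|ek] := boolP (odd k); first by right; apply: (outcome_right_inv ok nx Ew).
left; rewrite nx andbT; move: sw; rewrite size_cat size_rcons size_nseq oddD /=.
by rewrite (negbTE ek) addbT negbK.
Qed.

Lemma outcome_P w : outcome true w -> P_position (shape w).
Proof.
have [n] := ubnP (size w); elim: n w => // n IHn w sw Ew.
constructor=> mu /(crim_move_shape _ (outcome_normal Ew))[u [c [v [e ->]]]].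
have [x [-> sx nx /winning_move[u' [c' [v' [y [ex ey Ey sy]]]]]]] := losing_move Ew e.
apply: (N_position_intro (mu := shape y)); last by apply: IHn => //; lia.
by apply/(crim_move_shape _ nx); exists u', c', v'.
Qed.

Lemma outcome_N w : odd (size w) && normal w \/ outcome false w -> N_position (shape w).
Proof.
move=> Nw; have nw : normal w by case: Nw => [/andP[]//|/outcome_normal].
have [u [c [v [x [e ex Ex _]]]]] := winning_move Nw.
apply: (N_position_intro (mu := shape x)); last exact: outcome_P.
by apply/(crim_move_shape _ nw); exists u, c, v.
Qed.

(** Playing the winning move against the forced reply descends two moves in the derivation of
    [P_position]. The explicit [fix] recurses through the mutual predicates. *)
Lemma P_not_N lam : P_position lam -> N_position lam -> False.
Proof.
move: lam; fix PN 2 => lam [Pl] [mu m Pm].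
by case: (Pl mu m) => nu m' Pn; case: Pm => Pm; apply: (PN nu Pn (Pm nu m')).
Qed.

(** * Staircases and padded staircases *)

Fixpoint staircase_word (n : nat) : step_word :=
  if n is n'.+1 then true :: false :: staircase_word n' else [::].

Lemma outcome_staircase n : outcome (~~ odd n) (staircase_word n).
Proof.
elim: n => [|n IHn]; first exact: outcome_nil.
exact: (@outcome_left _ 1 (staircase_word n)).
Qed.

Lemma count_staircase_word n : count_mem false (staircase_word n) = n.
Proof. by elim: n => //= n ->. Qed.

Lemma staircaseS n : staircase n.+1 = n.+1 :: staircase n.
Proof. by rewrite /staircase -{1}[n.+1]addn1 iotaD rev_cat add1n. Qed.

Lemma row_lengths_staircase n : row_lengths (staircase_word n) = staircase n.
Proof.
by elim: n => // n IHn; rewrite staircaseS /= IHn count_staircase_word.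
Qed.

Lemma last_staircase_word n : last false (staircase_word n) = false.
Proof. by elim: n. Qed.

Lemma shape_staircase n : shape (staircase_word n) = staircase n.
Proof. by rewrite shape_row_lengths ?row_lengths_staircase ?last_staircase_word. Qed.

Lemma shape_padded n : 0 < n -> shape (true :: staircase_word n) = padded_staircase n.
Proof.
move=> n0; rewrite shape_row_lengths /= ?row_lengths_staircase ?count_staircase_word //.
by case: n n0 => //= n _; rewrite last_staircase_word.
Qed.

Lemma shape_doubly_padded n :
  shape (true :: rcons (staircase_word n) false) = doubly_padded_staircase n.
Proof.
rewrite shape_row_lengths /= ?last_rcons // row_lengths_rcons_col row_lengths_staircase.
rewrite -cats1 count_cat count_staircase_word /= addn1 /staircase map_rev.
by rewrite -(iotaDl 1 1).
Qed.

Lemma transpose_staircase n : transpose (staircase_word n) = staircase_word n.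
Proof.
elim: n => // n IHn; rewrite !transpose_cons IHn /=.
by elim: n {IHn} => //= n ->.
Qed.

(** The word R (RC)^n C begins with R R and ends with C C, so it is stable with empty runs at both
    ends. *)
Lemma outcome_doubly_padded n : 0 < n ->
  outcome true (true :: rcons (staircase_word n) false).
Proof.
case: n => // n _; apply: outcome_stable; first by exists 0; eexists.
  rewrite transpose_cons -(cats1 (staircase_word _)) transpose_cat transpose_staircase.
  by exists 0; eexists.
rewrite /= size_rcons /= !negbK.
by elim: n => //= n; rewrite negbK.
Qed.

(** * Quadrated partitions *)

(** Between two rows the walk crosses as many columns as their lengths differ; the default 0 makes
    the final run as long as the last part. *)
Fixpoint boundary (lam : seq nat) : step_word :=
  if lam is a :: s then true :: nseq (a - head 0 s) false ++ boundary s else [::].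

Lemma row_lengths_boundary lam : sorted geq lam ->
  row_lengths (boundary lam) = lam /\ count_mem false (boundary lam) = head 0 lam.
Proof.
elim: lam => //= a s IHs slam; have [IHr IHc] := IHs (path_sorted slam).
have ha : head 0 s <= a by case: s slam {IHs IHr IHc} => //= b s /andP[].
have row_lengths_cols k w : row_lengths (nseq k false ++ w) = row_lengths w.
  by elim: k.
by rewrite row_lengths_cols IHr count_cat count_nseq IHc mul1n subnK.
Qed.

Lemma shape_boundary lam : is_partition lam -> shape (boundary lam) = lam.
Proof.
case/andP=> slam /all_filterP flam.
by rewrite /shape (row_lengths_boundary slam).1.
Qed.

(** Parity forces a second copy of the largest part, and the order puts it next. Removing both
    copies preserves the parity of every multiplicity. *)
Lemma quadrated_pair a s : sorted geq (a :: s) -> quadrated (a :: s) ->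
  exists2 t, s = a :: t & quadrated t.
Proof.
move=> slam qlam; have [_] := qlam _ (mem_head a s); rewrite /= eqxx add1n /= negbK.
case: s slam qlam => //= b t /andP[/= ba st] qlam oc.
have ab : a <= b.
  case: (eqVneq b a) oc => [->//|nab]; rewrite add0n => oc.
  have : a \in t by rewrite -has_pred1 has_count; case: count oc.
  by move/(allP (order_path_min geq_trans st)).
have eab : b = a by lia.
subst b; exists t => // p pt; have [] := qlam p _; first by rewrite !inE pt !orbT.
by move=> ep; rewrite /= addnA addnn oddD odd_double.
Qed.

(** Each pair of equal rows contributes R R and an even run of C's, so the word begins with R R. The
    right end comes from the last pair, whose run is even and positive and so ends with C C; earlier
    pairs only prepend letters. *)
Lemma quadrated_boundary lam : is_partition lam -> quadrated lam ->
  ~~ odd (size (boundary lam)) /\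
  (lam = [::] \/ left_stable (boundary lam) /\ left_stable (transpose (boundary lam))).
Proof.
have [n] := ubnP (size lam); elim: n lam => // n IHn [|a s] sn; first by split; last left.
case/andP=> slam alam qlam; have [t es qt] := quadrated_pair slam qlam; subst s.
have pt : is_partition t.
  apply/andP; split; first by case: (t) slam => //= b t' /and3P[].
  by move: alam => /= /and3P[].
have [|et rt] := IHn t _ pt qt; first by move: sn => /=; lia.
have ea : ~~ odd a by have [] := qlam a (mem_head _ _).
have ha : head 0 t <= a by case: (t) slam => //= b t' /and3P[].
have eh : ~~ odd (head 0 t).
  case: (t) (qt) => //= b t' q; by have [] := q b (mem_head _ _).
split; last right.
  by rewrite /= subnn /= size_cat size_nseq oddD (negbTE et) oddB // (negbTE ea) (negbTE eh).
split; first by rewrite /= subnn; exists 0; eexists.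
case: rt => [t0|[_ rt]].
  subst t; rewrite /= subnn subn0 cats0 /=.
  case: a ea alam {slam qlam sn ha} => // -[] // a _ _.
  rewrite 2!transpose_cons transpose_nseq.
  by exists 0; eexists.
rewrite /= subnn /= !transpose_cons transpose_cat -!cats1 -!catA.
exact: left_stable_cat.
Qed.

Theorem proposition15 :
  (forall n : nat, 1 <= n -> (P_position (staircase n) <-> ~~ odd n)) /\
  (forall n : nat, 2 <= n -> N_position (padded_staircase n)) /\
  (forall n : nat, 2 <= n -> P_position (doubly_padded_staircase n)) /\
  (forall lam : seq nat,
     is_partition lam -> quadrated lam -> P_position lam).
Proof.
split; [|split; [|split]].
- move=> n _; rewrite -shape_staircase; have := outcome_staircase n.
  case: (odd n) => /= E; split=> //; last by move=> _; apply: outcome_P.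
  by move/P_not_N; case; apply: outcome_N; right.
- move=> [//|n] _; rewrite -shape_padded //; apply: outcome_N; left; apply/andP; split.
    by rewrite /= negbK; elim: n => //= n; rewrite negbK.
  by rewrite /normal /= last_staircase_word.
- move=> n n2; rewrite -shape_doubly_padded; apply/outcome_P/outcome_doubly_padded.
  by lia.
move=> lam plam qlam; rewrite -(shape_boundary plam); apply: outcome_P.
have [es [->|[l r]]] := quadrated_boundary plam qlam; first exact: outcome_nil.
exact: outcome_stable.
Qed.
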